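(* Let $\mathfrak{g}$ be a finite-dimensional real solvable Lie algebra equipped with an invariant scalar product $\langle\cdot,\cdot\rangle$ which is Einstein, and let $s$ be the Witt index of $\langle\cdot,\cdot\rangle$. Let $\mathfrak{n}$ be the nilradical of $\mathfrak{g}$. If $\mathfrak{g}$ is not nilpotent, then $\dim\mathfrak{g}\geq 6$, $\dim\mathfrak{n}\geq 5$ and $s\geq 2$.
   Context: A scalar product on $\mathfrak{g}$ is a non-degenerate symmetric bilinear form; it is invariant if $\langle [x,y_1],y_2\rangle=-\langle y_1,[x,y_2]\rangle$ for all $x,y_1,y_2\in\mathfrak{g}$. The Witt index is the maximal dimension of a totally isotropic subspace (a subspace $\mathfrak{v}$ with $\mathfrak{v}\subset\mathfrak{v}^\perp$). The invariant scalar product is called Einstein if the bi-invariant pseudo-Riemannian metric on a connected Lie group with Lie algebra $\mathfrak{g}$ obtained by left translation of $\langle\cdot,\cdot\rangle$ is an Einstein metric ($\mathrm{Ric}=\lambda\,\mathtt{g}$ for a constant $\lambda$); for solvable $\mathfrak{g}$ this is equivalent to the vanishing of the Killing form $\kappa(x,y)=\mathrm{tr}(\mathrm{ad}(x)\mathrm{ad}(y))$. *)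

(* Defs.v *)
(* A finite-dimensional real Lie algebra of dimension n is
   modelled on row vectors 'rV[R]_n with a bracket br; subspaces are matrices
   (row spaces, mxalgebra). *)
From HB Require Import structures.
From mathcomp Require Import all_boot all_order all_algebra.
From mathcomp Require Import reals.
Set Implicit Arguments. Unset Strict Implicit. Unset Printing Implicit Defensive.
Import Order.TTheory GRing.Theory Num.Theory.
Local Open Scope ring_scope.

Section LieDefs.
Variables (R : realType) (n : nat).
Notation V := 'rV[R]_n.

Definition ev (i : 'I_n) : V := delta_mx 0 i.

Definition is_lie_bracket (br : V -> V -> V) : Prop :=
  [/\ (forall (a : R) x y z, br (a *: x + y) z = a *: br x z + br y z),
      (forall (a : R) x y z, br z (a *: x + y) = a *: br z x + br z y),
      (forall x, br x x = 0) &
      (forall x y z, br x (br y z) + br y (br z x) + br z (br x y) = 0)].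

Definition brspace (br : V -> V -> V) (A C : 'M[R]_n) : 'M[R]_n :=
  (\sum_(i < n) \sum_(j < n) <<br (row i A) (row j C)>>)%MS.

Definition derived_series (br : V -> V -> V) (k : nat) : 'M[R]_n :=
  iter k (fun A => brspace br A A) 1%:M.

Definition solvable_lie (br : V -> V -> V) : Prop := exists k, derived_series br k = 0.

Definition lcs (br : V -> V -> V) (I : 'M[R]_n) (k : nat) : 'M[R]_n :=
  iter k (fun A => brspace br I A) I.

Definition nilpotent_sub (br : V -> V -> V) (I : 'M[R]_n) : Prop := exists k, lcs br I k = 0.

Definition nilpotent_lie (br : V -> V -> V) : Prop := nilpotent_sub br 1%:M.

Definition is_ideal (br : V -> V -> V) (I : 'M[R]_n) : Prop :=
  forall x y : V, (y <= I)%MS -> (br x y <= I)%MS.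

Definition is_nilradical (br : V -> V -> V) (N : 'M[R]_n) : Prop :=
  [/\ is_ideal br N, nilpotent_sub br N &
      forall I : 'M[R]_n, is_ideal br I -> nilpotent_sub br I -> (I <= N)%MS].

Definition form (B : 'M[R]_n) (x y : V) : R := (x *m B *m y^T) 0 0.

Definition invariant_scalar_product (br : V -> V -> V) (B : 'M[R]_n) : Prop :=
  [/\ B^T = B, B \in unitmx &
      forall x y1 y2, form B (br x y1) y2 = - form B y1 (br x y2)].

Definition totally_isotropic (B : 'M[R]_n) (W : 'M[R]_n) : Prop :=
  forall u v : V, (u <= W)%MS -> (v <= W)%MS -> form B u v = 0.

Definition is_witt_index (B : 'M[R]_n) (s : nat) : Prop :=
  (exists W, totally_isotropic B W /\ \rank W = s) /\
  (forall W, totally_isotropic B W -> (\rank W <= s)%N).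

(* Levi-Civita connection of the left-invariant metric on left-invariant
   vector fields (Koszul formula):
   2<nabla_x y, z> = <[x,y],z> - <[y,z],x> + <[z,x],y>. *)
Definition levi (br : V -> V -> V) (B : 'M[R]_n) (x y : V) : V :=
  (\row_k ((form B (br x y) (ev k) - form B (br y (ev k)) x
            + form B (br (ev k) x) y) / 2)) *m invmx B.

Definition curv (br : V -> V -> V) (B : 'M[R]_n) (x y z : V) : V :=
  levi br B x (levi br B y z) - levi br B y (levi br B x z)
  - levi br B (br x y) z.

Definition ricci (br : V -> V -> V) (B : 'M[R]_n) (y z : V) : R := \sum_(i < n) (curv br B (ev i) y z) 0 i.

Definition einstein (br : V -> V -> V) (B : 'M[R]_n) : Prop :=
  exists lam : R, forall y z : V, ricci br B y z = lam * form B y z.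

End LieDefs.

(* Main.v *)
(** For a bi-invariant metric Ric = -(1/4) Killing form. The Killing form of a
    solvable algebra vanishes on a nonzero abelian ideal, so the Einstein
    constant is 0 and tr (ad x)^2 = 0 for every x. If g is not nilpotent, some
    A = ad x is not nilpotent; on its invertible Fitting part V the form is
    nondegenerate and A is skew and invertible with tr A^2 = 0. Skewness and
    invertibility make dim V even, and in dimension 2 one has
    tr A^2 = -2 det A <> 0, so dim V >= 4. Moreover V is contained in [g,g] and
    orthogonal to x, while [g,g] is not orthogonal to x, so dim [g,g] >= 5; it
    is a proper nilpotent ideal.
    The form is indefinite on V, since a nonzero skew operator of a definite
    space has tr A^2 < 0, which gives an isotropic w in V. Together with a
    nonzero central z in [g,g], which is orthogonal to [g,g], it spans a totally
    isotropic plane: A is injective on V and kills z. *)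
Require Import Defs.
From HB Require Import structures.
From mathcomp Require Import all_boot all_order all_algebra.
From mathcomp Require Import boolp reals.
From mathcomp Require Import ring.
Import Order.TTheory GRing.Theory Num.Theory.
Local Open Scope ring_scope.
Set Implicit Arguments. Unset Strict Implicit. Unset Printing Implicit Defensive.

(** * Fitting decomposition and nilpotent matrices *)

Lemma unitmxX (F : fieldType) (m : nat) (A : 'M[F]_m) k :
  A \in unitmx -> A ^+ k \in unitmx.
Proof.
move=> uA; elim: k => [|k IH]; first exact: unitmx1.
by rewrite exprS -mulmxE unitmx_mul uA.
Qed.

Lemma unitmx_expr_eq0 (F : fieldType) (m : nat) (A : 'M[F]_m) k :
  A \in unitmx -> A ^+ k = 0 -> m = 0%N.
Proof.
move=> /(unitmxX k) uA A0; case: m A uA A0 => // m A uA A0.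
by move: uA; rewrite A0 unitmxE det0 unitr0.
Qed.

Lemma intertwineX (F : fieldType) (m p : nat) (T : 'M[F]_(p, m)) (A : 'M_p)
  (C : 'M_m) k : A *m T = T *m C -> A ^+ k *m T = T *m C ^+ k.
Proof.
move=> AT; elim: k => [|k IH]; first by rewrite !expr0 mul1mx mulmx1.
by rewrite exprS -mulmxE -mulmxA IH mulmxA AT -mulmxA mulmxE -exprS.
Qed.

(** Induction on the size: a singular [A] factors through its row space, and swapping the two
    factors keeps the trace and gives a smaller nilpotent matrix. *)
Lemma mxtrace_nilpotent (F : fieldType) (m : nat) (A : 'M[F]_m) k :
  A ^+ k = 0 -> \tr A = 0.
Proof.
elim/ltn_ind: m A k => m IH A k Ak0.
have [lt_rm|] := ltnP (\rank A) m; last first.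
  move=> le_mr; have uA : A \in unitmx.
    by rewrite -row_free_unit /row_free eqn_leq rank_leq_row.
  by have m0 := unitmx_expr_eq0 uA Ak0; subst m; rewrite /mxtrace big_ord0.
rewrite -[A]mulmx_base mxtrace_mulC; apply: (IH _ lt_rm _ k.+1).
have /(intertwineX k) : row_base A *m col_base A *m row_base A = row_base A *m A.
  by rewrite -mulmxA mulmx_base.
rewrite Ak0 mulmx0 exprSr => EA0.
by rewrite -mulmxE mulmxA EA0 mul0mx.
Qed.

(** Doubling the exponent keeps the rank or lowers it, and the latter happens finitely often.
    Positivity of [k] excludes the trivial solution [k = 0]. *)
Lemma stable_rank (F : fieldType) (m : nat) (A : 'M[F]_m) :
  exists2 k, (0 < k)%N & \rank (A ^+ (k + k)) = \rank (A ^+ k).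
Proof.
suff H d k : (0 < k)%N -> (\rank (A ^+ k) <= d)%N ->
    exists2 k', (0 < k')%N & \rank (A ^+ (k' + k')) = \rank (A ^+ k').
  exact: (H (\rank (A ^+ 1)) 1%N).
elim: d k => [|d IH] k k0 led.
  exists k => //; move: led; rewrite leqn0 => /eqP A0.
  by have := mxrankM_maxl (A ^+ k) (A ^+ k); rewrite A0 leqn0 mulmxE -exprD => /eqP.
have := mxrankM_maxl (A ^+ k) (A ^+ k); rewrite mulmxE -exprD leq_eqVlt.
case/orP => [/eqP eqA|ltA]; first by exists k.
by apply: (IH (k + k)%N); [rewrite addn_gt0 k0 | rewrite -ltnS (leq_trans ltA)].
Qed.

(* Fitting decomposition: [C] is the invertible part of [A], living on the row
   space of [E], and [F *m E] is the projection onto it along the nil part. *)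
Lemma fitting (K : fieldType) (m : nat) (A : 'M[K]_m) :
  exists r (E : 'M_(r, m)) (F : 'M_(m, r)) (C : 'M_r) k,
  [/\ E *m F = 1%:M, E *m A = C *m E, A *m F = F *m C, C \in unitmx &
      (0 < k)%N /\ A ^+ k = F *m C ^+ k *m E].
Proof.
have [k k0 rk] := stable_rank A.
have [r [L [E [LE fL fE]]]] : exists r (L : 'M_(m, r)) (E : 'M_(r, m)),
    [/\ L *m E = A ^+ k, row_full L & row_free E].
  exists _, (col_base (A ^+ k)), (row_base (A ^+ k)).
  by rewrite mulmx_base col_base_full row_base_free.
set M := A ^+ k in rk LE.
have EK : E *m pinvmx E = 1%:M := mulmxVp fE.
(* [M *m M] is [L *m (E *m L) *m E] and still has rank [r], so its middle factor is invertible. *)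
have uN : E *m L \in unitmx.
  rewrite -row_free_unit /row_free eqn_leq rank_leq_row /=.
  have rM : \rank M = r by rewrite -LE mxrankMfree // (eqP fL).
  rewrite -{1}rM -rk exprD -/M -mulmxE -LE mulmxA -[L *m E *m L]mulmxA.
  exact: leq_trans (mxrankM_maxl _ _) (mxrankM_maxr _ _).
move defN: (E *m L) uN => N uN.
have AM : A *m M = M *m A by rewrite !mulmxE /M -exprS -exprSr.
have LfL : pinvmx L *m L = 1%:M := mulVpmx fL.
have [C EA] : exists C, E *m A = C *m E.
  exists (pinvmx L *m A *m L).
  have E1 : E = pinvmx L *m M by rewrite -LE mulmxA LfL mul1mx.
  by rewrite {1}E1 -mulmxA -AM -LE !mulmxA.
have CL : A *m L = L *m C.
  have : A *m L *m E = L *m C *m E.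
    by rewrite -!mulmxA -EA LE mulmxA LE.
  by move=> /(congr1 (mulmx^~ (pinvmx E))); rewrite -!mulmxA EK !mulmx1.
have CN : C *m N = N *m C by rewrite -defN mulmxA -EA -!mulmxA CL.
have CN' : C *m invmx N = invmx N *m C.
  by rewrite -[LHS](mulKmx uN) [N *m _]mulmxA -CN -mulmxA mulmxV // mulmx1.
have CkE : C ^+ k *m E = N *m E.
  by rewrite (intertwineX k (esym EA)) -/M -LE mulmxA defN.
have Ck : C ^+ k = N.
  by move: (congr1 (mulmx^~ (pinvmx E)) CkE); rewrite -!mulmxA EK !mulmx1.
have uC : C \in unitmx.
  by have := uN; rewrite -Ck -(prednK k0) exprS -mulmxE unitmx_mul => /andP[].
exists _, E, (L *m invmx N), C, k; split=> //.
- by rewrite mulmxA defN mulmxV.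
- by rewrite mulmxA CL -!mulmxA CN'.
- split=> //; rewrite Ck -/M -[L *m _ *m N]mulmxA mulVmx // mulmx1 LE //.
Qed.

(** With [B] and [D] the powers of [A] and [C], the remainder [B - F *m D *m E] is nilpotent, hence
    traceless, and [F *m D *m E] has the trace of [D] by cyclicity. *)
Lemma fitting_trace (K : fieldType) (m r : nat) (A : 'M[K]_m) (E : 'M_(r, m))
    (F : 'M_(m, r)) (C : 'M_r) k j :
  E *m F = 1%:M -> E *m A = C *m E -> A *m F = F *m C ->
  A ^+ k = F *m C ^+ k *m E -> \tr (A ^+ j.+1) = \tr (C ^+ j.+1).
Proof.
move=> EF EA AF Ak; set D := C ^+ j.+1; set B := A ^+ j.+1.
have EB : D *m E = E *m B by apply: intertwineX.
have BF : B *m F = F *m D by apply: intertwineX.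
have step i : (B - F *m D *m E) ^+ i.+1 = B ^+ i.+1 - F *m D ^+ i.+1 *m E.
  elim: i => [//|i IH]; rewrite exprS IH -mulmxE mulmxBl !mulmxBr.
  have EBi := intertwineX i.+1 EB.
  rewrite [B ^+ i.+2]exprS [D ^+ i.+2]exprS -!mulmxE.
  move: (B ^+ i.+1) (D ^+ i.+1) EBi => Bi Di EBi.
  have -> : B *m (F *m Di *m E) = F *m (D *m Di) *m E by rewrite !mulmxA BF.
  have -> : F *m D *m E *m Bi = F *m (D *m Di) *m E.
    by rewrite -mulmxA -EBi !mulmxA.
  have -> : F *m D *m E *m (F *m Di *m E) = F *m (D *m Di) *m E.
    by rewrite !mulmxA -[_ *m E *m F]mulmxA EF mulmx1.
  by rewrite subrr subr0.
have : \tr (B - F *m D *m E) = 0.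
  apply: (@mxtrace_nilpotent _ _ _ k.+1).
  have le_k : (k <= j.+1 * k.+1)%N by apply: leq_trans (leqnSn k) (leq_pmull _ _).
  rewrite step /B /D -!exprM -(subnKC le_k) !exprD Ak -!mulmxE.
  have := intertwineX (j.+1 * k.+1 - k) (esym EA).
  move: (A ^+ _) (C ^+ _) (C ^+ k) => An Cn Ck EAn.
  by rewrite -[_ *m E *m An]mulmxA -EAn !mulmxA subrr.
rewrite raddfB /= => /eqP; rewrite subr_eq0 => /eqP ->.
by rewrite mxtrace_mulC mulmxA EF mul1mx.
Qed.

(* In the traced Cayley-Hamilton identity of the invertible Fitting part only
   the constant term, det times its size, survives. *)
Lemma nilpotent_of_traces (K : numFieldType) (m : nat) (A : 'M[K]_m) :
  (forall j, \tr (A ^+ j.+1) = 0) -> exists k, A ^+ k = 0.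
Proof.
move=> trA; have [r [E [F [C [k [EF EA AF uC [_ Ak]]]]]]] := fitting A.
suff r0 : r = 0%N.
  by exists k; rewrite Ak {EF EA AF uC Ak}; subst r; rewrite (flatmx0 E) mulmx0.
have trC j : \tr (C ^+ j.+1) = 0 by rewrite -(fitting_trace _ EF EA AF Ak).
case: r => [//|r] in E F C EF EA AF uC Ak trC *.
have /(congr1 (@mxtrace _ _)) := Cayley_Hamilton C.
rewrite -[char_poly C]coefK poly_def !raddf_sum /= size_char_poly big_ord_recl.
rewrite big1 => [|i _]; last first.
  by rewrite linearZ rmorphXn /= horner_mx_X linearZ /= trC mulr0.
rewrite addr0 linearZ rmorphXn /= expr0 linearZ /= mxtrace1 raddf0.
move/eqP; rewrite mulf_eq0 pnatr_eq0 orbF char_poly_det mulf_eq0 signr_eq0 /=.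
by move: uC; rewrite unitmxE unitfE => /negPf ->.
Qed.

(** As [y] commutes with [c], each [c ^+ j.+1] is the commutator of [c ^+ j * x] and [y], so its
    trace vanishes. *)
Lemma jacobson_nilpotent (K : numFieldType) (m : nat) (x y c : 'M[K]_m) :
  c = x * y - y * x -> c * y = y * c -> exists k, c ^+ k = 0.
Proof.
move=> defc cy; apply: nilpotent_of_traces => j.
rewrite exprSr {2}defc mulrBr raddfB /= !mulrA -!mulmxE mxtrace_mulC !mulmxE.
by rewrite mulrA (commrX j (esym cy)) subrr.
Qed.

(** The operators are treated one by one: [v] is replaced by its last nonzero image under powers of
    [f i], and commutation keeps the earlier operators killing it. *)
Lemma common_kernel (K : fieldType) (m : nat) (I : finType) (f : I -> 'M[K]_m) :
  (0 < m)%N ->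
  (forall i j, f i * f j = f j * f i) -> (forall i, exists k, f i ^+ k = 0) ->
  exists2 v : 'rV_m, v != 0 & forall i, v *m f i = 0.
Proof.
move=> m0 fC f0.
suff [v v0 vf] : exists2 v : 'rV_m, v != 0 & {in enum I, forall i, v *m f i = 0}.
  by exists v => // i; apply: vf; rewrite mem_enum.
elim: (enum I) => [|i s [v v0 vs]].
  exists (const_mx 1) => //.
  by apply/eqP => /rowP /(_ (Ordinal m0)) /eqP; rewrite !mxE oner_eq0.
have ex : exists k, v *m f i ^+ k == 0.
  by have [k fk] := f0 i; exists k; rewrite fk mulmx0.
case: (ex_minnP ex) => -[|k] /eqP vk kmin.
  by move: v0; rewrite -[v]mulmx1 -[1%:M]/(f i ^+ 0) vk eqxx.
exists (v *m f i ^+ k); first by apply/negP => /kmin; rewrite ltnn.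
move=> j; rewrite inE => /predU1P [->|js].
  by rewrite -mulmxA mulmxE -exprSr vk.
by rewrite -mulmxA mulmxE -(commrX k (fC j i)) -mulmxE mulmxA vs // mul0mx.
Qed.

(** * Solvable Lie algebras *)

Section LieAlgebra.
Variables (R : realType) (n : nat) (br : 'rV[R]_n -> 'rV[R]_n -> 'rV[R]_n).
Hypothesis lie : is_lie_bracket br.

Lemma brDl x y z : br (x + y) z = br x z + br y z.
Proof. by case: lie => L _ _ _; have := L 1 x y z; rewrite !scale1r. Qed.

Lemma brDr x y z : br z (x + y) = br z x + br z y.
Proof. by case: lie => _ L _ _; have := L 1 x y z; rewrite !scale1r. Qed.

Lemma br0l z : br 0 z = 0.
Proof. by apply: (addrI (br 0 z)); rewrite -brDl !addr0. Qed.

Lemma br0r z : br z 0 = 0.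
Proof. by apply: (addrI (br z 0)); rewrite -brDr !addr0. Qed.

Lemma brZl a x z : br (a *: x) z = a *: br x z.
Proof. by case: lie => L _ _ _; have := L a x 0 z; rewrite br0l !addr0. Qed.

Lemma brZr a x z : br z (a *: x) = a *: br z x.
Proof. by case: lie => _ L _ _; have := L a x 0 z; rewrite br0r !addr0. Qed.

Lemma brC x y : br x y = - br y x.
Proof.
case: lie => _ _ L _; have := L (x + y); rewrite brDl !brDr !L add0r addr0.
by move/eqP; rewrite addr_eq0 => /eqP.
Qed.

Lemma br_jacobi x y z : br x (br y z) = br (br x y) z + br y (br x z).
Proof.
case: lie => _ _ _ /(_ x y z) /eqP; rewrite -addrA addr_eq0 => /eqP ->.
rewrite (brC z (br x y)) (brC z x) -[- br x z]scaleN1r brZr scaleN1r.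
by rewrite opprD !opprK addrC.
Qed.

Lemma br_suml (I : finType) (f : I -> 'rV[R]_n) z : br (\sum_i f i) z = \sum_i br (f i) z.
Proof. by apply: (big_morph (br^~ z)) => [x y|]; rewrite ?brDl ?br0l. Qed.

Lemma br_sumr (I : finType) (f : I -> 'rV[R]_n) z : br z (\sum_i f i) = \sum_i br z (f i).
Proof. by apply: (big_morph (br z)) => [x y|]; rewrite ?brDr ?br0r. Qed.

Lemma mem_brspace (A C : 'M[R]_n) x y :
  (x <= A)%MS -> (y <= C)%MS -> (br x y <= brspace br A C)%MS.
Proof.
move=> /submxP[a ->] /submxP[c ->]; rewrite !mulmx_sum_row br_suml.
apply: summx_sub => i _; rewrite br_sumr; apply: summx_sub => j _.
rewrite brZl brZr scalemx_sub // scalemx_sub //.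
apply: (submx_trans _ (sumsmx_sup i _ _)) => //.
by apply: (submx_trans _ (sumsmx_sup j _ _)) => //; rewrite genmxE.
Qed.

Lemma brspace_row_ind (A C : 'M[R]_n) (P : 'rV[R]_n -> Prop) :
  P 0 -> (forall a x y, P x -> P y -> P (a *: x + y)) ->
  (forall i j, P (br (row i A) (row j C))) ->
  forall u, (u <= brspace br A C)%MS -> P u.
Proof.
move=> P0 PL Pbr u.
have PD x y : P x -> P y -> P (x + y) by move=> Px; rewrite -[x]scale1r; apply: PL.
case/sub_sumsmxP => v ->; apply: (big_ind P) => // i _.
have : (v i *m (\sum_j <<br (row i A) (row j C)>>)%MS <= \sum_j <<br (row i A) (row j C)>>)%MS.
  exact: submxMl.
case/sub_sumsmxP => w ->; apply: (big_ind P) => // j _.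
have : (w j *m <<br (row i A) (row j C)>>%MS <= br (row i A) (row j C))%MS.
  by rewrite (submx_trans (submxMl _ _)) // genmxE.
case/sub_rVP => a ->; rewrite -[_ *: _]addr0; exact: PL.
Qed.

Lemma brspace_ind (A C : 'M[R]_n) (P : 'rV[R]_n -> Prop) :
  P 0 -> (forall a x y, P x -> P y -> P (a *: x + y)) ->
  (forall x y, (x <= A)%MS -> (y <= C)%MS -> P (br x y)) ->
  forall u, (u <= brspace br A C)%MS -> P u.
Proof.
by move=> P0 PL Pbr; apply: brspace_row_ind => // i j; apply: Pbr; apply: row_sub.
Qed.

Lemma brspace_sub (A C D : 'M[R]_n) :
  (forall x y, (x <= A)%MS -> (y <= C)%MS -> (br x y <= D)%MS) ->
  (brspace br A C <= D)%MS.
Proof.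
move=> H; apply/rV_subP; apply: brspace_ind => //; first exact: sub0mx.
by move=> a x y xD yD; rewrite addmx_sub // scalemx_sub.
Qed.

Local Notation D := (derived_series br).

Lemma derivedS k : D k.+1 = brspace br (D k) (D k). Proof. by []. Qed.

Lemma derived_ideal k : is_ideal br (D k).
Proof.
elim: k => [|k IH] x y; first by rewrite !submx1.
move: y; apply: brspace_ind => [|a u v bu bv|u v Du Dv].
- by rewrite br0r sub0mx.
- by rewrite brDr brZr addmx_sub // scalemx_sub.
- by rewrite br_jacobi addmx_sub // mem_brspace // IH.
Qed.

Lemma mem_derived1 x y : (br x y <= D 1)%MS.
Proof. by rewrite mem_brspace ?submx1. Qed.

(* Right action on row vectors, so the bracket is reversed. *)
Definition representation m (rho : 'rV[R]_n -> 'M[R]_m) : Prop :=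
  (forall a x y, rho (a *: x + y) = a *: rho x + rho y) /\
  (forall x y, rho (br x y) = rho y * rho x - rho x * rho y).

(** * Representations of a solvable algebra *)

Section Representation.
Variables (m : nat) (rho : 'rV[R]_n -> 'M[R]_m).
Hypothesis rep : representation rho.

Lemma repD x y : rho (x + y) = rho x + rho y.
Proof. by have := rep.1 1 x y; rewrite !scale1r. Qed.

Lemma rep0 : rho 0 = 0.
Proof. by apply: (addrI (rho 0)); rewrite -repD !addr0. Qed.

Lemma rep_comm x y : rho (br x y) = 0 -> rho x * rho y = rho y * rho x.
Proof. by rewrite rep.2 => /eqP; rewrite subr_eq0 => /eqP. Qed.

Lemma rep_brspace0 (A C : 'M[R]_n) :
  (forall x y, (x <= A)%MS -> (y <= C)%MS -> rho (br x y) = 0) ->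
  forall u, (u <= brspace br A C)%MS -> rho u = 0.
Proof.
move=> H; apply: brspace_ind => //; first exact: rep0.
by move=> a x y rx ry; rewrite rep.1 rx ry scaler0 addr0.
Qed.

(** In the first case [T] includes an invariant subspace and [S] retracts onto it; in the second [S]
    projects to a quotient and [T] lifts from it. *)
Lemma rep_compress p (T : 'M[R]_(p, m)) (S : 'M[R]_(m, p)) :
  (forall x, T *m rho x *m S *m T = T *m rho x) \/
  (forall x, S *m (T *m rho x *m S) = rho x *m S) ->
  representation (fun x => T *m rho x *m S).
Proof.
move=> H; split=> [a x y|x y].
  by rewrite rep.1 mulmxDr mulmxDl -scalemxAr -scalemxAl.
have cM u v : T *m rho u *m S * (T *m rho v *m S) = T *m (rho u * rho v) *m S.
  rewrite -!mulmxE; case: H => [H|H]; first by rewrite !mulmxA H.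
  have -> : T *m rho u *m S *m (T *m rho v *m S) = T *m rho u *m (S *m (T *m rho v *m S)).
    by rewrite -!mulmxA.
  by rewrite H !mulmxA.
by rewrite !cM rep.2 mulmxBr mulmxBl.
Qed.

Definition irreducible : Prop := forall W : 'M[R]_m,
  (forall x, (W *m rho x <= W)%MS) -> W = 0 \/ row_full W.

Hypothesis irr : irreducible.

(** Schur's argument: the kernel of [c] is invariant. If it is 0, then [c] is both invertible and
    nilpotent, which leaves only the zero space. *)
Lemma irr_central_nilpotent c k :
  (forall x, rho x * c = c * rho x) -> c ^+ k = 0 -> c = 0.
Proof.
move=> cC ck.
have [x| |full] := @irr (kermx c).
- by apply/sub_kermxP; rewrite -mulmxA mulmxE cC -mulmxE mulmxA mulmx_ker mul0mx.
- move/eqP; rewrite kermx_eq0 row_free_unit => uc.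
  have m0 := unitmx_expr_eq0 uc ck.
  by clear -m0; subst m; rewrite [c]flatmx0.
- have [B defB] := row_fullP full.
  by rewrite -[c]mul1mx -defB -mulmxA mulmx_ker mulmx0.
Qed.

Hypothesis sol : solvable_lie br.

(** Lie's theorem for irreducible representations, without eigenvalues: a commutator that commutes
    with one of its factors is nilpotent, and a central nilpotent operator is 0. *)
Lemma irr_derived0 u : (u <= D 1)%MS -> rho u = 0.
Proof.
have [K DK] := sol.
(* Downward induction along the derived series, starting just after [D K = 0]. *)
suff H j k : (j + k.+1 = K.+1)%N -> forall u, (u <= D k.+1)%MS -> rho u = 0.
  exact: (H K 0%N (addn1 K)).
elim: j k => [|j IH] k.
  rewrite add0n => -[->] v; rewrite derivedS DK; apply: rep_brspace0 => x y.
  by rewrite submx0 => /eqP ->; rewrite br0l rep0.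
rewrite addSnnS => /IH {}IH.
have comm a b : (a <= D k.+1)%MS -> (b <= D k.+1)%MS -> rho a * rho b = rho b * rho a.
  by move=> aD bD; apply: rep_comm; apply: IH; apply: mem_brspace.
(* The generators of the ideal [J] act by commuting nilpotent operators, so for [m > 0] their common
   kernel [W] is nonzero. It is invariant, hence everything. *)
pose J := brspace br (D k.+1) 1%:M.
have JD v : (v <= J)%MS -> (v <= D k.+1)%MS.
  move/submx_trans; apply; apply: brspace_sub => x y xD _.
  by rewrite brC eqmx_opp derived_ideal.
have Jideal x v : (v <= J)%MS -> (br v x <= J)%MS.
  by move=> /JD vD; apply: mem_brspace; rewrite ?submx1.
have J0 v : (v <= J)%MS -> rho v = 0.
  have [m0 _|m0] := posnP m.
    by apply/matrixP => i; have := ltn_ord i; rewrite {2}m0.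
  pose g (ij : 'I_n * 'I_n) := br (row ij.1 (D k.+1)) (row ij.2 1%:M).
  have gD i : (g i <= D k.+1)%MS.
    by apply: JD; apply: mem_brspace; rewrite ?row_sub ?submx1.
  have [||w w0 wg] := @common_kernel _ _ _ (fun i => rho (g i)) m0.
  - by move=> i j'; apply: comm.
  - move=> i; apply: jacobson_nilpotent (rep.2 _ _) _.
    exact: comm (gD i) (row_sub _ _).
  pose W := (\bigcap_i kermx (rho (g i)))%MS.
  have memW (y : 'rV_m) : (y <= W)%MS <-> (forall v, (v <= J)%MS -> y *m rho v = 0).
    split=> [yW|yJ].
      apply: brspace_row_ind => [|a x z yx yz|i l].
      + by rewrite rep0 mulmx0.
      + by rewrite rep.1 mulmxDr -scalemxAr yx yz scaler0 addr0.
      + by apply/sub_kermxP; move/sub_bigcapmxP: yW => /(_ (i, l)); apply.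
    apply/sub_bigcapmxP => i _; apply/sub_kermxP; apply: yJ.
    by apply: mem_brspace; rewrite ?row_sub ?submx1.
  have [x|W0|full] := @irr W.
  + apply/row_subP=> i; rewrite row_mul; apply/memW => v' vJ.
    have /memW iW := row_sub i W.
    have := rep.2 v' x; move/eqP; rewrite eq_sym subr_eq => /eqP xv.
    by rewrite -mulmxA mulmxE xv mulmxDr iW ?Jideal // add0r -mulmxE mulmxA iW // mul0mx.
  + have : (w <= W)%MS by apply/sub_bigcapmxP => i _; apply/sub_kermxP.
    by rewrite W0 submx0 (negPf w0).
  + move=> vJ; apply/row_matrixP => i; rewrite row0 rowE.
    by move/memW: (submx_full (delta_mx 0 i : 'rV_m) full); apply.
(* Since [J] acts by zero, [D k.+1] acts centrally, and so each bracket of elements of [D k] acts by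
   a central nilpotent operator. *)
have central x a : (a <= D k.+1)%MS -> rho x * rho a = rho a * rho x.
  by move=> aD; apply/esym/rep_comm; apply: J0; apply: mem_brspace; rewrite ?submx1.
apply: rep_brspace0 => a b aD bD.
have abD : (br a b <= D k.+1)%MS by apply: mem_brspace.
have [i ci] := jacobson_nilpotent (rep.2 a b) (esym (central a _ abD)).
by apply: irr_central_nilpotent ci => x; apply: central.
Qed.
End Representation.

(* Lie's and Engel's theorems at once, in the form of simultaneous strict
   triangularisability. *)
Lemma strictly_triangular m (rho : 'rV[R]_n -> 'M[R]_m) :
  solvable_lie br -> representation rho ->
  exists k, forall s : seq 'rV[R]_n, size s = k ->
    (forall x, x \in s -> (x <= D 1)%MS \/ exists j, rho x ^+ j = 0) ->
    \prod_(x <- s) rho x = 0.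
Proof.
move=> sol; elim/ltn_ind: m rho => m IH rho rep.
have [irr|red] := EM (irreducible rho).
  (* All operators commute because [D 1] acts by zero; the nilpotent ones are then 0, so products of
     length 1 already vanish. *)
  have d0 u : (u <= D 1)%MS -> rho u = 0 by apply: irr_derived0.
  exists 1%N => -[|x [|//]] //= _ Sx; rewrite big_seq1.
  have [|xD|[j xj]] := Sx x; rewrite ?inE //; first exact: d0.
  apply: (irr_central_nilpotent irr _ xj) => y.
  by apply: rep_comm rep _ _ _; apply: d0; apply: mem_derived1.
have [W [WM W0 Wfull]] : exists W : 'M[R]_m,
    [/\ forall x, (W *m rho x <= W)%MS, W != 0 & ~~ row_full W].
  apply: contrapT => noW; apply: red => W WM.
  have [->|W0] := eqVneq W 0; [by left|right].
  by apply: contrapT => /negP Wf; apply: noW; exists W.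
(* [E] and [E'] include [W] and retract onto it; [F] and [F'] project to the quotient and lift from
   it. *)
pose E := row_base W; pose E' := pinvmx E.
have EE : E *m E' = 1%:M by apply: mulmxVp (row_base_free W).
pose F := col_base (cokermx W); pose F' := pinvmx F.
have FF : F' *m F = 1%:M by apply: mulVpmx (col_base_full _).
have memE p (A : 'M_(p, m)) : (A <= W)%MS -> A *m E' *m E = A.
  by move=> AW; rewrite mulmxKpV // eq_row_base.
have memF p (A : 'M_(p, m)) : (A <= W)%MS = (A *m F == 0).
  by rewrite submxE -(mulmx_free_eq0 (A *m F) (row_base_free (cokermx W))) -mulmxA mulmx_base.
have EW : (E <= W)%MS by rewrite eq_row_base.
clearbody E' F' E F.
have Erho x : E *m rho x *m E' *m E = E *m rho x.
  by apply: memE; apply: submx_trans (WM x); rewrite submxMr.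
have Frho x : F *m (F' *m rho x *m F) = rho x *m F.
  apply/eqP; rewrite -subr_eq0 !mulmxA -mulmxBl -{2}[rho x]mul1mx -mulmxBl -memF.
  apply: submx_trans (WM x); rewrite submxMr // memF mulmxBl -mulmxA FF mulmx1.
  by rewrite mul1mx subrr.
have ltE : (\rank W < m)%N.
  by rewrite ltn_neqAle rank_leq_col andbT.
have ltF : (\rank (cokermx W) < m)%N.
  rewrite mxrank_coker ltn_subrL lt0n mxrank_eq0 W0 /=.
  by apply: leq_ltn_trans ltE.
have repE := rep_compress rep (or_introl Erho).
have repF := rep_compress rep (or_intror Frho).
have [k1 H1] := IH _ ltE _ repE; have [k2 H2] := IH _ ltF _ repF.
(* On row vectors, the first [k2] factors send everything into [W] and the last [k1] kill [W]. *)
exists (k2 + k1)%N => s szs Ss.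
rewrite -(cat_take_drop k2 s) big_cat /= -[_ * _]/(_ *m _).
have P2 : \prod_(x <- take k2 s) rho x *m F = 0.
  have -> : \prod_(x <- take k2 s) rho x *m F
      = F *m \prod_(x <- take k2 s) (F' *m rho x *m F).
    elim: (take k2 s) => [|x l IHl]; first by rewrite !big_nil mul1mx mulmx1.
    by rewrite !big_cons -!mulmxE -mulmxA IHl !mulmxA -Frho !mulmxA.
  rewrite H2 ?mulmx0 //; first by rewrite size_take_min szs; apply/minn_idPl/leq_addr.
  move=> x /mem_take /Ss [|[j xj]]; [by left|right; exists j].
  have := intertwineX j (esym (Frho x)).
  by rewrite xj mul0mx => /(congr1 (mulmx F')); rewrite mulmxA FF mul1mx mulmx0.
have P1 : E *m \prod_(x <- drop k2 s) rho x = 0.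
  have -> : E *m \prod_(x <- drop k2 s) rho x
      = \prod_(x <- drop k2 s) (E *m rho x *m E') *m E.
    elim: (drop k2 s) => [|x l IHl]; first by rewrite !big_nil mul1mx mulmx1.
    by rewrite !big_cons -!mulmxE -mulmxA -IHl !mulmxA Erho.
  rewrite H1 ?mul0mx //; first by rewrite size_drop szs addKn.
  move=> x /mem_drop /Ss [|[j xj]]; [by left|right; exists j].
  have := intertwineX j (Erho x).
  by rewrite xj mulmx0 => /(congr1 (mulmx^~ E')); rewrite -mulmxA EE mulmx1 mul0mx.
move: (\prod_(x <- take k2 s) rho x) (\prod_(x <- drop k2 s) rho x) P2 P1.
move=> A1 A2 /eqP; rewrite -memF => /memE <- P1.
by rewrite -(mulmxA _ E) P1 mulmx0.
Qed.

(** * The adjoint representation and nilpotency *)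

Definition ad (x : 'rV[R]_n) : 'M[R]_n := \matrix_i br x (row i 1%:M).

Lemma mul_ad x y : y *m ad x = br x y.
Proof.
rewrite mulmx_sum_row -[in RHS](mulmx1 y) mulmx_sum_row br_sumr.
by apply: eq_bigr => i _; rewrite rowK brZr.
Qed.

Lemma mulmx_rV_inj p q (A A' : 'M[R]_(p, q)) :
  (forall y : 'rV_p, y *m A = y *m A') -> A = A'.
Proof. by move=> AA; apply/row_matrixP => i; rewrite !rowE. Qed.

Lemma ad_rep : representation ad.
Proof.
split=> [a x y|x y]; apply: mulmx_rV_inj => z.
  by rewrite mulmxDr -scalemxAr !mul_ad brDl brZl.
by rewrite mulmxBr -!mulmxE !mulmxA !mul_ad br_jacobi addrK.
Qed.

Lemma lcs_nilpotent (I : 'M[R]_n) :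
  solvable_lie br ->
  (forall x, (x <= I)%MS -> (x <= D 1)%MS \/ exists j, ad x ^+ j = 0) ->
  nilpotent_sub br I.
Proof.
move=> sol SI; have [k Hk] := strictly_triangular sol ad_rep.
(* Each step in [j] moves one factor [ad x] between the nested bracket and the list [s]; the case
   [j = k] with the empty list is the claim. *)
exists k; suff H j s (y : 'rV_n) : (j + size s = k)%N -> all (fun x => x <= I)%MS s ->
    (y <= lcs br I j)%MS -> y *m \prod_(x <- s) ad x = 0.
  apply/eqP; rewrite -submx0; apply/rV_subP => y yI.
  by have := H k [::] y; rewrite big_nil mulmx1 => ->; rewrite ?addn0 ?sub0mx.
elim: j s y => [|j IH] s y szs sI.
  by rewrite Hk ?mulmx0 // => x /(allP sI) /SI.
move: y; apply: brspace_ind => [|a x y x0 y0|x y xI yI].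
- by rewrite mul0mx.
- by rewrite mulmxDl -scalemxAl x0 y0 scaler0 addr0.
have := IH (x :: s) y; rewrite big_cons -mulmxE mulmxA mul_ad.
apply=> //; first by rewrite addnS -szs.
by rewrite /= xI.
Qed.
End LieAlgebra.

(** * Skew-symmetric operators *)

(** Orthogonalisation: anisotropy makes the corner [g] invertible, so [L] splits it off, and the
    Schur complement [S] is again anisotropic. *)
Lemma anisotropic_diag (K : fieldType) r (G : 'M[K]_r) :
  G^T = G -> (forall v : 'rV_r, v *m G *m v^T = 0 -> v = 0) ->
  exists2 P : 'M_r, P \in unitmx & exists d : 'rV_r, P *m G *m P^T = diag_mx d.
Proof.
elim: r G => [|r IH] G sG aG.
  by exists 1%:M; [apply: unitmx1 | exists 0; rewrite [LHS]flatmx0 [RHS]flatmx0].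
move: G sG aG; rewrite -[r.+1]/(1 + r)%N => G sG aG.
set g := ulsubmx G; set b := ursubmx G; set H := drsubmx G.
have Gb : G = block_mx g b b^T H.
  by rewrite -{1}(submxK G); congr block_mx; rewrite /b trmx_ursub sG.
have sg : g^T = g by rewrite /g trmx_ulsub sG.
have sH : H^T = H by rewrite /H trmx_drsub sG.
have ug : g \in unitmx.
  rewrite unitmxE unitfE det_mx11; apply/eqP => g0.
  have : row_mx 1%:M 0 = 0 :> 'rV[K]_(1 + r).
    apply: aG; rewrite Gb mul_row_block tr_row_mx mul_row_col trmx0 mulmx0 addr0.
    rewrite !mul1mx mul0mx addr0 trmx1 mulmx1.
    by apply/matrixP => i j; rewrite !ord1 g0 mxE.
  move/eqP; rewrite row_mx_eq0 => /andP[/eqP /matrixP /(_ 0 0)].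
  by rewrite !mxE => /eqP; rewrite oner_eq0.
have gK : b^T *m invmx g *m g = b^T by rewrite -mulmxA mulVmx // mulmx1.
pose L : 'M_(1 + r) := block_mx 1%:M 0 (- (b^T *m invmx g)) 1%:M.
have uL : L \in unitmx by rewrite unitmxE det_lblock !det1 mulr1 unitr1.
pose S := H - b^T *m invmx g *m b.
have LG : L *m G *m L^T = block_mx g 0 0 S.
  rewrite Gb /L mulmx_block tr_block_mx mulmx_block !mul1mx !mul0mx !trmx1 !trmx0.
  rewrite !mulmx0 !mulmx1 !addr0 !mulNmx gK addNr mul0mx !add0r.
  by rewrite linearN /= trmx_mul trmxK trmx_inv sg mulmxN mulmxA mulmxV // mul1mx addNr addrC.
have sS : S^T = S.
  by rewrite /S linearB /= !trmx_mul trmxK trmx_inv sg sH mulmxA.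
have [v Sv|P uP [d Pd]] := IH S sS.
  have /(congr1 (mulmx^~ (invmx L))) : row_mx 0 v *m L = 0 :> 'rV[K]_(1 + r).
    apply: aG; rewrite trmx_mul !mulmxA -[_ *m L *m G]mulmxA -[_ *m _ *m L^T]mulmxA LG.
    rewrite mul_row_block tr_row_mx mul_row_col !mul0mx !mulmx0 !addr0 !add0r.
    by rewrite mul0mx add0r.
  rewrite mulmxK // mul0mx => /eqP; rewrite row_mx_eq0 => /andP[_ /eqP] //.
pose Q : 'M_(1 + r) := block_mx 1%:M 0 0 P.
have uQ : Q \in unitmx by rewrite unitmxE det_lblock det1 mul1r -unitmxE.
exists (Q *m L); first by rewrite unitmx_mul uQ.
exists (row_mx g d).
rewrite trmx_mul !mulmxA -[Q *m L *m G]mulmxA -[Q *m _ *m L^T]mulmxA LG.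
rewrite tr_block_mx !mulmx_block !mul1mx !mul0mx !trmx1 !trmx0 !mulmx0 !mulmx1 !addr0 !mul0mx.
rewrite !add0r Pd diag_mx_row. congr block_mx.
by apply/matrixP => i j; rewrite !ord1 !mxE.
Qed.

(** On an anisotropic space all diagonal entries [d] have one sign. Skewness then makes minus the
    trace of the square a sum of nonnegative terms, whose vanishing forces the invertible operator
    to be 0. *)
Lemma skew_isotropic (K : rcfType) r (G C : 'M[K]_r) :
  (0 < r)%N -> G^T = G -> C \in unitmx -> C *m G = - (G *m C^T) ->
  \tr (C *m C) = 0 -> exists2 v : 'rV_r, v != 0 & v *m G *m v^T = 0.
Proof.
move=> r0 sG uC CG trC; apply: contrapT => noiso.
have aG (v : 'rV_r) : v *m G *m v^T = 0 -> v = 0.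
  by move=> vG; apply/eqP; apply: contrapT => /negP v0; apply: noiso; exists v.
have [P uP [d Pd]] := anisotropic_diag sG aG.
have aD (u : 'rV_r) : \sum_i u 0 i ^+ 2 * d 0 i = 0 -> u = 0.
  move=> ud; have : u *m P = 0.
    apply: aG; rewrite trmx_mul !mulmxA -[_ *m P *m G]mulmxA -[_ *m _ *m P^T]mulmxA Pd.
    apply/matrixP => i j; rewrite !ord1 mul_mx_diag !mxE -[RHS]ud.
    by apply: eq_bigr => k _; rewrite !mxE expr2 mulrAC.
  by move=> /(congr1 (mulmx^~ (invmx P))); rewrite mulmxK // mul0mx.
have pos i j : 0 < d 0 j / d 0 i.
  have d0 k : d 0 k != 0.
    apply/eqP => dk.
    suff /aD /rowP /(_ k) /eqP : \sum_i (delta_mx 0 k : 'rV[K]_r) 0 i ^+ 2 * d 0 i = 0.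
      by rewrite !mxE !eqxx oner_eq0.
    rewrite (bigD1 k) //= dk mulr0 add0r big1 // => l /negPf lk.
    by rewrite mxE eqxx lk expr0n mul0r.
  rewrite ltNge; apply/negP => le0.
  have neg : 0 <= - (d 0 i / d 0 j) by rewrite oppr_ge0 -invf_div invr_le0.
  have ij : j != i.
    by apply/eqP => ji; move: le0; rewrite ji divff // leNgt ltr01.
  (* This [t] makes [u] isotropic when the two entries of [d] have opposite signs. *)
  pose t := Num.sqrt (- (d 0 i / d 0 j)).
  pose u : 'rV[K]_r := delta_mx 0 i + t *: delta_mx 0 j.
  suff /aD /rowP /(_ i) /eqP : \sum_k u 0 k ^+ 2 * d 0 k = 0.
    by rewrite !mxE !eqxx [i == j]eq_sym (negPf ij) mulr0 addr0 oner_eq0.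
  rewrite (bigD1 i) //= (bigD1 j) //= big1 => [|k /andP[/negPf ki /negPf kj]].
    rewrite !mxE !eqxx (negPf ij) [i == j]eq_sym (negPf ij) mulr0 !addr0 add0r mulr1.
    by rewrite expr1n mul1r sqr_sqrtr // mulNr divfK // subrr.
  by rewrite !mxE ki kj mulr0 addr0 expr0n mul0r.
pose C' := P *m C *m invmx P.
have C'D : C' *m diag_mx d = - (diag_mx d *m C'^T).
  rewrite -Pd /C' !trmx_mul trmx_inv !mulmxA mulmxKV // -[P *m C *m G]mulmxA CG.
  by rewrite mulmxK ?unitmx_tr // mulmxN mulNmx !mulmxA.
have C'ij i j : C' i j * d 0 j = - (d 0 i * C' j i).
  by move/matrixP/(_ i j): C'D; rewrite mul_mx_diag mul_diag_mx !mxE.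
have C'ji i j : C' j i = - (C' i j * (d 0 j / d 0 i)).
  have := pos i i; have := C'ij i j.
  case: (eqVneq (d 0 i) 0) => [->|di e _]; first by rewrite !mul0r ltxx.
  by rewrite mulrA e mulNr opprK mulrC mulKf.
have tr0 : \sum_i \sum_j C' i j ^+ 2 * (d 0 j / d 0 i) = 0.
  apply/eqP; rewrite -oppr_eq0 -sumrN; apply/eqP; rewrite -[RHS]trC.
  have -> : \tr (C *m C) = \tr (C' *m C').
    by rewrite /C' !mulmxA mulmxKV // [RHS]mxtrace_mulC !mulmxA mulVmx // mul1mx.
  rewrite /mxtrace; apply: eq_bigr => i _; rewrite mxE -sumrN; apply: eq_bigr => j _.
  by rewrite [C' j i]C'ji mulrN expr2 -mulrA.
have nn i j : 0 <= C' i j ^+ 2 * (d 0 j / d 0 i) by rewrite mulr_ge0 ?sqr_ge0 ?ltW.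
have C'0 : C' = 0.
  apply/matrixP => i j; rewrite [RHS]mxE; apply/eqP.
  move/eqP: tr0; rewrite psumr_eq0 => [|k _]; last by apply: sumr_ge0.
  move/allP/(_ i); rewrite mem_index_enum => /(_ isT) /=.
  rewrite psumr_eq0 // => /allP/(_ j); rewrite mem_index_enum => /(_ isT) /=.
  by rewrite mulf_eq0 (gt_eqF (pos i j)) orbF sqrf_eq0.
have : C' \in unitmx by rewrite !unitmx_mul uP uC unitmx_inv.
by rewrite C'0 -row_free_unit /row_free mxrank0 => /eqP r00; rewrite -r00 in r0.
Qed.

Lemma det2_traces (K : numFieldType) (C : 'M[K]_2) :
  \tr (C *m C) = \tr C ^+ 2 - 2 * \det C.
Proof.
have e01 : lift ord0 ord0 = 1 :> 'I_2 by apply/val_inj.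
have e10 : lift 1 ord0 = 0 :> 'I_2 by apply/val_inj.
have sum2 (f : 'I_2 -> K) : \sum_i f i = f 0 + f 1.
  by rewrite !big_ord_recl big_ord0 addr0 e01.
rewrite (expand_det_row _ 0) /mxtrace !sum2 ![(C *m C) _ _]mxE !sum2 /cofactor.
have minor i j : \det (row' i (col' j C)) = C (lift i ord0) (lift j ord0).
  by rewrite det_mx11 !mxE; congr (C (lift i _) (lift j _)); apply/val_inj.
rewrite !minor !e01 !e10 /=.
ring.
Qed.

(** [C *m G] is antisymmetric and invertible, so [r] is even. For [r = 2], skewness gives
    [\tr C = 0], and the trace of the square is [- 2 * \det C], which is nonzero. *)
Lemma skew_rank (K : numFieldType) r (G C : 'M[K]_r) :
  (0 < r)%N -> G^T = G -> G \in unitmx -> C \in unitmx ->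
  C *m G = - (G *m C^T) -> \tr (C *m C) = 0 -> (4 <= r)%N.
Proof.
move=> r0 sG uG uC CG trC.
have even_r : ~~ odd r.
  apply/negP => odd_r.
  have detCG : \det (C *m G) != 0 by rewrite -unitfE -unitmxE unitmx_mul uC.
  have : \det (C *m G) = - \det (C *m G).
    rewrite -{1}det_tr trmx_mul sG -[G *m _]opprK -CG -scaleN1r detZ.
    by rewrite -signr_odd odd_r mulN1r.
  move/eqP; rewrite -addr_eq0 -mulr2n mulrn_eq0 /=.
  by rewrite (negPf detCG).
have r2 : r != 2%N.
  apply/eqP => r2; subst r.
  have trC0 : \tr C = 0.
    have : \tr C = - \tr C.
      have CE : C = - (G *m C^T *m invmx G) by rewrite -mulNmx -CG mulmxK.
      by rewrite {1}CE raddfN /= mxtrace_mulC mulmxA mulVmx // mul1mx mxtrace_tr.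
    by move/eqP; rewrite -addr_eq0 -mulr2n mulrn_eq0 /= => /eqP.
  move: trC; rewrite det2_traces trC0 expr0n add0r => /eqP.
  rewrite oppr_eq0 mulf_eq0 pnatr_eq0 /=.
  by move: uC; rewrite unitmxE unitfE => /negPf ->.
by case: r r0 even_r r2 {sG uG uC CG trC G C} => [|[|[|[|]]]].
Qed.

(* The invertible Fitting part of a skew-symmetric operator is a nondegenerate
   subspace, so the two lemmas on invertible skew operators apply to it. *)
Lemma skew_fitting (K : rcfType) n (A B : 'M[K]_n) :
  B^T = B -> B \in unitmx -> A *m B = - (B *m A^T) ->
  \tr (A *m A) = 0 -> (forall k, A ^+ k != 0) ->
  exists r (E : 'M_(r, n)) (C : 'M_r),
  [/\ (4 <= r)%N, row_free E, E *m A = C *m E, C \in unitmx &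
      exists2 v : 'rV_r, v != 0 & v *m E *m B *m (v *m E)^T = 0].
Proof.
move=> sB uB AB trA nilA; have [r [E [F [C [k [EF EA AF uC [k0 Ak]]]]]]] := fitting A.
have r0 : (0 < r)%N.
  rewrite lt0n; apply/eqP => r0; have /eqP := nilA k; apply.
  by rewrite Ak {EF EA AF uC Ak}; subst r; rewrite (flatmx0 E) mulmx0.
pose G := E *m B *m E^T.
have sG : G^T = G by rewrite /G !trmx_mul trmxK sB mulmxA.
have CG : C *m G = - (G *m C^T).
  rewrite /G !mulmxA -EA -(mulmxA E) AB mulmxN mulNmx.
  by rewrite -!mulmxA -!trmx_mul EA.
have AkB : A ^+ k *m B = (-1) ^+ k *: (B *m (A ^+ k)^T).
  elim: (k) => [|i IH]; first by rewrite !expr0 trmx1 mul1mx mulmx1 scale1r.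
  rewrite exprS -mulmxE -mulmxA IH -scalemxAr mulmxA AB mulNmx scalerN -scaleNr.
  by rewrite exprS mulN1r -mulmxA -trmx_mul mulmxE -exprSr -exprS.
(* [A ^+ k] is self-adjoint up to the sign [e], so [e *: Ck] is [G] times a matrix; as [Ck] is
   invertible, so is [G]. *)
have uG : G \in unitmx.
  have ss : (-1) ^+ k * (-1) ^+ k = 1 :> K by rewrite -exprMn mulrNN mulr1 expr1n.
  have := unitmxX k uC; move: (A ^+ k) (C ^+ k) ((-1) ^+ k) Ak AkB ss.
  move=> N Ck e NE NB ee uCk.
  have BN : B *m E^T *m Ck^T *m F^T = e *: (N *m B).
    by rewrite NB scalerA ee scale1r NE !trmx_mul !mulmxA.
  have : G *m (Ck^T *m F^T *m invmx B *m F) = e *: Ck.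
    rewrite /G; transitivity (E *m (B *m E^T *m Ck^T *m F^T) *m invmx B *m F).
      by rewrite !mulmxA.
    rewrite BN -scalemxAr -!scalemxAl; congr (_ *: _).
    by rewrite mulmxA mulmxK // NE !mulmxA EF mul1mx -mulmxA EF mulmx1.
  have eC : (e *: Ck) *m (e *: invmx Ck) = 1%:M.
    by rewrite -scalemxAl -scalemxAr scalerA ee scale1r mulmxV.
  move=> /(congr1 (mulmx^~ (e *: invmx Ck))); rewrite /= eC -(mulmxA G).
  by case/mulmx1_unit.
have trC : \tr (C *m C) = 0.
  by rewrite mulmxE -expr2 -(fitting_trace _ EF EA AF Ak) expr2.
exists r, E, C; split=> //.
- exact: skew_rank sG uG uC CG trC.
- by apply/row_freeP; exists F.
have [v v0 vG] := skew_isotropic r0 sG uC CG trC.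
by exists v => //; rewrite trmx_mul !mulmxA -vG /G !mulmxA.
Qed.

(** * Invariant scalar products *)

Section MetricLie.
Variables (R : realType) (n : nat) (br : 'rV[R]_n -> 'rV[R]_n -> 'rV[R]_n).
Variable B : 'M[R]_n.
Hypotheses (lie : is_lie_bracket br) (inv : invariant_scalar_product br B).
Local Notation form := Defs.form.
Local Notation D := (derived_series br).
Local Notation ad := (ad br).

Let sB : B^T = B. Proof. by case: inv. Qed.
Let uB : B \in unitmx. Proof. by case: inv. Qed.

Lemma form_br x y z : form B (br x y) z = - form B y (br x z).
Proof. by case: inv => _ _; apply. Qed.

Lemma formC x y : form B x y = form B y x.
Proof.
by rewrite /form -[x *m B *m y^T]trmxK mxE !trmx_mul trmxK sB mulmxA.
Qed.

Lemma formDl x y z : form B (x + y) z = form B x z + form B y z.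
Proof. by rewrite /form !mulmxDl mxE. Qed.

Lemma formZl a x y : form B (a *: x) y = a * form B x y.
Proof. by rewrite /form -!scalemxAl mxE. Qed.

Lemma formNl x y : form B (- x) y = - form B x y.
Proof. by rewrite -scaleN1r formZl mulN1r. Qed.

Lemma form0l x : form B 0 x = 0.
Proof. by rewrite /form !mul0mx mxE. Qed.

Lemma form_brl x y z : form B (br x y) z = form B x (br y z).
Proof. by rewrite brC // formNl form_br opprK. Qed.

Lemma form_ev x i : form B x (ev R i) = (x *m B) 0 i.
Proof. by rewrite /form /ev trmx_delta -colE mxE. Qed.

Lemma form_nondeg x : (forall y, form B x y = 0) -> x = 0.
Proof.
move=> x0; have : x *m B = 0 by apply/rowP => i; rewrite -form_ev x0 mxE.
by move=> /(congr1 (mulmx^~ (invmx B))); rewrite mulmxK // mul0mx.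
Qed.

(** * Adjoint action and curvature of an invariant metric *)

Lemma ad_skew x : ad x *m B = - (B *m (ad x)^T).
Proof.
apply: mulmx_rV_inj => y; apply/rowP => i; rewrite mulmxA mul_ad // -form_ev form_br.
rewrite mulmxN [RHS]mxE; congr (- _).
by rewrite -(mul_ad lie) /form trmx_mul /ev trmx_delta !mulmxA -colE mxE.
Qed.

(** By invariance the last two terms of the Koszul formula cancel. *)
Lemma leviE x y : levi br B x y = 2^-1 *: br x y.
Proof.
have -> : 2^-1 *: br x y = (2^-1 *: (br x y *m B)) *m invmx B by rewrite scalemxAl mulmxK.
rewrite /levi; congr (_ *m _); apply/rowP => k; rewrite [LHS]mxE [RHS]mxE -form_ev.
rewrite [form B (br y _) x]formC -form_brl [form B (br _ x) y]form_brl.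
by rewrite [form B (ev R k) _]formC subrr add0r mulrC.
Qed.

(** By the Jacobi identity the curvature is [- 4^-1 *: br (br x y) z], which as a map of [x] is a
    multiple of [ad y *m ad z]. *)
Lemma ricciE y z : ricci br B y z = - 4^-1 * \tr (ad y *m ad z).
Proof.
rewrite /ricci /mxtrace mulr_sumr; apply: eq_bigr => i _.
have -> : curv br B (ev R i) y z = - 4^-1 *: (ev R i *m (ad y *m ad z)).
  rewrite mulmxA !mul_ad // /curv !leviE !(brZr lie) !scalerA.
  rewrite (br_jacobi lie (ev R i) y z) scalerDr addrK.
  rewrite (brC lie y (ev R i)) (brC lie z) -[- br (ev R i) y]scaleN1r (brZl lie).
  rewrite scaleN1r opprK -scalerBl; congr (_ *: _).
  by field.
rewrite mxE; congr (_ * _).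
by rewrite -rowE mxE.
Qed.

(** The last nonzero term of the derived series. *)
Lemma abelian_ideal : (0 < n)%N -> solvable_lie br ->
  exists A : 'M[R]_n, [/\ A != 0, is_ideal br A &
    forall x y : 'rV_n, (x <= A)%MS -> (y <= A)%MS -> br x y = 0].
Proof.
move=> n0 [K DK].
have ex : exists k, D k == 0 by exists K; apply/eqP.
case: (ex_minnP ex) => -[|k] /eqP Dk kmin.
  move: Dk => /matrixP /(_ (Ordinal n0) (Ordinal n0)) /eqP.
  by rewrite !mxE eqxx oner_eq0.
exists (D k); split; [by apply/negP => /kmin; rewrite ltnn|exact: derived_ideal|].
move=> x y xD yD; apply/eqP; rewrite -submx0 -Dk.
exact: mem_brspace.
Qed.

(* The Einstein constant is zero because the Killing form vanishes on a nonzero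
   abelian ideal. *)
Lemma einstein_killing0 : solvable_lie br -> einstein br B ->
  forall x, \tr (ad x *m ad x) = 0.
Proof.
move=> sol [lam ricL] x.
have [n0|n0] := posnP n.
  by rewrite /mxtrace big1 // => i; have := ltn_ord i; rewrite {2}n0.
have [A [A0 idA abA]] := abelian_ideal n0 sol.
have [a aA a0] : exists2 a : 'rV_n, (a <= A)%MS & a != 0.
  apply: contrapT => H; move/eqP: A0; apply; apply/row_matrixP => i.
  rewrite row0; apply: contrapT => /eqP Ai; apply: H.
  by exists (row i A); rewrite ?row_sub.
have lam0 : lam = 0.
  have [//|l0] := eqVneq lam 0; exfalso; move/eqP: a0; apply.
  apply: form_nondeg => y; apply: (mulfI l0).
  (* For [a] in the abelian ideal, [ad a *m ad y] has image in that ideal after [ad a] has acted,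
     and a second [ad a] kills it: the square is 0. *)
  rewrite -ricL ricciE mulr0 (@mxtrace_nilpotent _ _ _ 2) ?mulr0 //.
  rewrite expr2 -!mulmxE !mulmxA; apply: mulmx_rV_inj => v; rewrite !mulmxA !mul_ad // mulmx0.
  rewrite (abA a) ?br0r //; apply: (idA); rewrite brC // eqmx_opp; exact: idA.
have := ricL x x; rewrite lam0 mul0r ricciE => /eqP.
by rewrite mulf_eq0 oppr_eq0 invr_eq0 pnatr_eq0 /= => /eqP.
Qed.

(** Engel's theorem, read contrapositively. *)
Lemma exists_nonnilpotent_ad : solvable_lie br -> ~ nilpotent_lie br ->
  exists x, forall k, ad x ^+ k != 0.
Proof.
move=> sol nnil; apply: contrapT => H; apply: nnil; apply: lcs_nilpotent => // x _.
right; apply: contrapT => xk; apply: H; exists x => k; apply/eqP => xk0.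
by apply: xk; exists k.
Qed.

(** * The derived algebra and its orthogonal *)

Lemma derived1_nilpotent : solvable_lie br -> nilpotent_sub br (D 1).
Proof. by move=> sol; apply: lcs_nilpotent => // x; left. Qed.

Lemma derived1_proper : (0 < n)%N -> solvable_lie br -> (\rank (D 1) < n)%N.
Proof.
move=> n0 [K DK]; rewrite ltn_neqAle rank_leq_col andbT; apply/negP => full.
suff H k : row_full (D k).
  by have := H K; rewrite DK /row_full mxrank0 => /eqP nn; rewrite -nn in n0.
elim: k => [|k IH]; first by rewrite row_full_unit unitmx1.
rewrite -sub1mx; apply: submx_trans (_ : (1%:M <= D 1)%MS) _; first by rewrite sub1mx.
by apply: brspace_sub => // x y _ _; apply: mem_brspace => //; apply: submx_full.
Qed.

Lemma orth_derived1_central z :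
  (forall u, (u <= D 1)%MS -> form B u z = 0) -> forall x, br x z = 0.
Proof.
move=> zD x; apply: form_nondeg => y.
by rewrite form_br formC zD ?oppr0 // mem_derived1.
Qed.

(* Otherwise the algebra is the sum of its derived algebra and of its centre,
   hence the derived algebra is perfect. *)
Lemma central_in_derived1 : solvable_lie br -> D 1 != 0 ->
  exists z : 'rV_n, [/\ z != 0, (z <= D 1)%MS &
    forall u : 'rV_n, (u <= D 1)%MS -> form B u z = 0].
Proof.
move=> [K DK] D0; apply: contrapT => noz.
pose Z := kermx (B *m (D 1)^T).
have Zorth (z u : 'rV_n) : (z <= Z)%MS -> (u <= D 1)%MS -> form B u z = 0.
  move=> /sub_kermxP zZ /submxP[w ->]; rewrite formC /form trmx_mul !mulmxA.
  by rewrite -(mulmxA z) zZ mul0mx mxE.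
have cap0 : (D 1 :&: Z)%MS = 0.
  apply/eqP; rewrite -submx0; apply/rV_subP => z; rewrite sub_capmx => /andP[zD zZ].
  rewrite submx0; apply: contrapT => /negP z0; apply: noz; exists z; split=> // u.
  exact: Zorth.
(* Nondegeneracy gives the orthogonal [Z] the dimension complementary to that of [D 1]. *)
have full : row_full (D 1 + Z)%MS.
  have := mxrank_sum_cap (D 1) Z; rewrite cap0 mxrank0 addn0 /row_full => ->.
  by rewrite mxrank_ker eqmxMfull ?row_full_unit // mxrank_tr subnKC ?rank_leq_row.
have Zc z x : (z <= Z)%MS -> br x z = 0.
  by move=> zZ; apply: orth_derived1_central => u uD; apply: Zorth.
suff H k : (D 1 <= D k.+1)%MS.
  move/eqP: D0; apply; apply/eqP; rewrite -submx0; apply: submx_trans (H K) _.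
  apply: (brspace_sub (A := D K) (C := D K)) => // x y xK _.
  have /eqP -> : x == 0 by rewrite -submx0 -DK.
  by rewrite br0l // sub0mx.
have split_br (x : 'rV_n) : exists2 u : 'rV_n, (u <= D 1)%MS & exists2 z, (z <= Z)%MS & x = u + z.
  have [[a b] /= ->] := sub_addsmxP (submx_full x full).
  by exists (a *m D 1); [|exists (b *m Z)]; rewrite ?submxMl.
elim: k => [|k IH]; first exact: submx_refl.
apply: (brspace_sub (A := D 0) (C := D 0)) => // x y _ _.
have [u uD [z zZ ->]] := split_br x; have [v vD [w wZ ->]] := split_br y.
rewrite (brDl lie) !(brDr lie) (Zc w) // (Zc w) // (brC lie z v) (Zc z) // oppr0 !addr0.
by rewrite derivedS; apply: (mem_brspace lie); apply: submx_trans IH.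
Qed.
(* The Fitting part of [ad x] lies in [[g, g]] and is orthogonal to [x], which
   [[g, g]] is not. *)
Lemma fitting_lt_derived1 r (E : 'M[R]_(r, n)) (C : 'M_r) x :
  row_free E -> E *m ad x = C *m E -> C \in unitmx -> ad x != 0 ->
  (E <= D 1)%MS /\ (r < \rank (D 1))%N.
Proof.
move=> freeE EA uC A0.
have EC : E = invmx C *m E *m ad x by rewrite -mulmxA EA mulKmx.
have ED : (E <= D 1)%MS.
  by apply/row_subP => i; rewrite EC row_mul (mul_ad lie) mem_derived1.
split=> //; rewrite ltnNge; apply/negP => le_r; move/eqP: A0; apply.
(* Otherwise [D 1] equals [E], whose vectors are brackets with [x] and so orthogonal to [x]; then
   [x] is central. *)
have DE : (D 1 <= E)%MS.
  by rewrite -(mxrank_leqif_sup ED) eqn_leq mxrankS //= (eqP freeE).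
have Ex (u : 'rV_n) : (u <= E)%MS -> form B u x = 0.
  case/submxP => w ->; rewrite EC !mulmxA (mul_ad lie) form_br formC.
  have -> : br x x = 0 by case: lie.
  by rewrite form0l oppr0.
apply: mulmx_rV_inj => y; rewrite mulmx0 (mul_ad lie).
apply: form_nondeg => z; rewrite form_brl formC.
by apply: Ex; apply: submx_trans DE; apply: mem_derived1.
Qed.

End MetricLie.

(** * The dimension bounds and the isotropic plane *)

Unset Implicit Arguments.

Theorem theorem1p2 (R : realType) (n : nat) (br : 'rV[R]_n -> 'rV[R]_n -> 'rV[R]_n)
    (B : 'M[R]_n) :
  is_lie_bracket br -> solvable_lie br ->
  invariant_scalar_product br B -> einstein br B ->
  ~ nilpotent_lie br ->
  [/\ (6 <= n)%N,
      (forall N : 'M[R]_n, is_nilradical br N -> (5 <= \rank N)%N) &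
      (forall s : nat, is_witt_index B s -> (2 <= s)%N)].
Proof.
move=> lie sol inv ein nnil; have [sB uB _] := inv.
have [x nilA] := exists_nonnilpotent_ad lie sol nnil.
have trA := einstein_killing0 lie inv sol ein x.
have [r [E [C [r4 freeE EA uC [v v0 isov]]]]] :=
  skew_fitting sB uB (ad_skew lie inv x) trA nilA.
have [ED ltD] := fitting_lt_derived1 lie inv freeE EA uC (nilA 1%N).
have D5 : (5 <= \rank (derived_series br 1))%N := leq_ltn_trans r4 ltD.
have n0 : (0 < n)%N by apply: leq_trans (rank_leq_col (derived_series br 1)); apply: leq_trans D5.
split.
- exact: leq_ltn_trans D5 (derived1_proper lie n0 sol).
- move=> N [_ _ maxN]; apply: leq_trans D5 _; apply: mxrankS; apply: maxN.
    exact: derived_ideal.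
  exact: derived1_nilpotent.
(* By maximality of [s], it suffices that the plane spanned by [w] and [z] is totally isotropic. *)
move=> s [_ maxs].
have D0 : derived_series br 1 != 0 by rewrite -mxrank_eq0 -lt0n; apply: leq_trans D5.
have [z [z0 zD zorth]] := central_in_derived1 lie inv sol D0.
pose w := v *m E.
have wD : (w <= derived_series br 1)%MS by apply: submx_trans (submxMl _ _) ED.
have ww : Defs.form B w w = 0 by rewrite /Defs.form isov mxE.
have zA : z *m ad br x = 0.
  by rewrite (mul_ad lie) (orth_derived1_central lie inv zorth).
have free : row_free (col_mx w z).
  rewrite -kermx_eq0 -submx0; apply/rV_subP => c /sub_kermxP.
  rewrite -[c]hsubmxK mul_row_col [lsubmx c]mx11_scalar [rsubmx c]mx11_scalar.
  move: (lsubmx c 0 0) (rsubmx c 0 0) => a b; rewrite !mul_scalar_mx => wz.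
  (* [ad br x] kills [z] and is injective on the row space of [E], which contains [w]. *)
  have a0 : a = 0.
    have [//|a0] := eqVneq a 0; move/negP: v0 => []; apply/eqP.
    move: (congr1 (mulmx^~ (ad br x)) wz).
    rewrite /w /= mulmxDl mul0mx -!scalemxAl zA scaler0 addr0 -mulmxA EA.
    move/eqP; rewrite scaler_eq0 (negPf a0) /= mulmxA mulmx_free_eq0 // => /eqP vC.
    by rewrite -(mulmxK uC v) vC mul0mx.
  move/eqP: wz; rewrite a0 scale0r add0r scaler_eq0 (negPf z0) orbF => /eqP ->.
  by rewrite !raddf0 row_mx0 sub0mx.
pose W := <<col_mx w z>>%MS.
have memW u : (u <= W)%MS -> exists a b, u = a *: w + b *: z.
  rewrite genmxE => /submxP[c ->]; exists (lsubmx c 0 0), (rsubmx c 0 0).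
  by rewrite -{1}[c]hsubmxK mul_row_col -!mul_scalar_mx -!mx11_scalar.
have isoW : totally_isotropic B W.
  move=> u u' /memW [a [b ->]] /memW [a' [b' ->]].
  rewrite (formDl B) !(formZl B) ![Defs.form B _ (_ + _)](formC inv).
  rewrite !(formDl B) !(formZl B) ww (zorth z zD) (formC inv z w) (zorth w wD).
  by rewrite !mulr0 !addr0 !mulr0 addr0.
have := maxs W isoW; rewrite genmxE.
by rewrite (eqP free).
Qed.
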